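(* Let $d\in\mathbb{N}$, let $\Omega\subset\mathbb{R}^d$ be a domain, and let $\mathcal{C}\subset\mathcal{D}$ be two normed spaces of (equivalence classes of) functions $\Omega\to\mathbb{R}$. Let $\varrho:\mathbb{R}\to\mathbb{R}$ be such that $\mathcal{NN}_\varrho^d\subset\mathcal{D}$. Assume that there are $\gamma=\gamma(\mathcal{C},\mathcal{D})>0$ and $C_1=C_1(\mathcal{C},\mathcal{D})>0$ with $$L_\varepsilon(\mathcal{C},\mathcal{D})\ge C_1\varepsilon^{-\gamma}\qquad\text{for all }\varepsilon>0 .$$ Then for each $C_0>0$ there exists a constant $C=C(\gamma,\mathcal{C},\mathcal{D},C_0)>0$ such that for each coding scheme for real numbers $\mathcal{B}$ and all $\varepsilon\in(0,1/2)$, $$M_\varepsilon^{\mathcal{B},\varrho,C_0}(\mathcal{C},\mathcal{D})\ \ge\ C\cdot\varepsilon^{-\gamma}\Big/\log_2\!\left(\frac1\varepsilon\right).$$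
   Context: $\mathbb{N}=\{1,2,\dots\}$. Neural networks. A neural network with input dimension $d=N_0$, $L$ layers and output dimension $N_L$ is a family $\Phi=((A_\ell,b_\ell))_{\ell=1}^L$ with $A_\ell\in\mathbb{R}^{N_\ell\times N_{\ell-1}}$, $b_\ell\in\mathbb{R}^{N_\ell}$ ($L,N_1,\dots,N_L\in\mathbb{N}$). The entries of the $A_\ell,b_\ell$ are its weights. For an activation function $\varrho:\mathbb{R}\to\mathbb{R}$ its realization $R_\varrho(\Phi):\Omega\to\mathbb{R}^{N_L}$ is $x\mapsto x_L$, where $x_0=x$, $x_\ell=\varrho(A_\ell x_{\ell-1}+b_\ell)$ for $\ell=1,\dots,L-1$ ($\varrho$ acting componentwise), and $x_L=A_Lx_{L-1}+b_L$. $\mathcal{NN}_\varrho^d$ is the set of all realizations $R_\varrho(\Phi)$ of networks with input dimension $d$ and output dimension $1$. Encodable weights. A coding scheme for real numbers is a sequence $\mathcal{B}=(B_\ell)_{\ell\in\mathbb{N}}$ of maps $B_\ell:\{0,1\}^\ell\to\mathbb{R}$. For $M>0$, $K\in\mathbb{N}$, $\mathcal{NN}^{\mathcal{B}}_{M,K,d}$ is the set of all neural networks with $d$-dimensional input, one-dimensional output and at most $M$ nonzero weights such that each nonzero weight lies in $\mathrm{Range}(B_K)$. For $f\in\mathcal{C}$, $\varepsilon>0$, $C_0>0$ put $$M^{\mathcal{B},\varrho,C_0}_\varepsilon(f)=\min\{M\in\mathbb{N}:\exists\,\Phi\in\mathcal{NN}^{\mathcal{B}}_{M,\lceil C_0\log_2(1/\varepsilon)\rceil,d}\text{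 with }\|f-R_\varrho(\Phi)\|_{\mathcal{D}}\le\varepsilon\}$$ (with $\min\emptyset=\infty$), and $M_\varepsilon^{\mathcal{B},\varrho,C_0}(\mathcal{C},\mathcal{D})=\sup_{f\in\mathcal{C},\,\|f\|_{\mathcal{C}}\le1}M_\varepsilon^{\mathcal{B},\varrho,C_0}(f)$. Minimax code length. For $\varepsilon>0$, $L_\varepsilon(\mathcal{C},\mathcal{D})$ is the minimum of all $\ell\in\mathbb{N}$ for which there exist maps $E:\mathcal{C}\to\{0,1\}^\ell$ and $D:\{0,1\}^\ell\to\mathcal{D}$ with $\sup_{f\in\mathcal{C},\,\|f\|_{\mathcal{C}}\le1}\|D(E(f))-f\|_{\mathcal{D}}\le\varepsilon$ ($\infty$ if there is none). *)

(* Defs.v *)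
From HB Require Import structures.
From mathcomp Require Import all_boot all_order all_algebra.
From mathcomp Require Import all_classical all_reals all_analysis.

Set Implicit Arguments.
Unset Strict Implicit.
Unset Printing Implicit Defensive.

Import Order.TTheory GRing.Theory Num.Theory.
Import numFieldNormedType.Exports.

Local Open Scope classical_set_scope.
Local Open Scope ring_scope.

(* [network R m n]: networks with input dimension [n] and output dimension [m],
   given layer by layer from the input side. The hidden widths are of the form
   [k.+1], so they are positive, and there is always at least one layer. *)
Inductive network (R : realType) (m : nat) : nat -> Type :=
| OutputLayer n : 'M[R]_(m, n) -> 'cV[R]_m -> network R m n
| HiddenLayer n k :
    'M[R]_(k.+1, n) -> 'cV[R]_(k.+1) -> network R m k.+1 -> network R m n.

Fixpoint realize (R : realType) (m n : nat) (rho : R -> R)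
    (Phi : network R m n) : 'cV[R]_n -> 'cV[R]_m :=
  match Phi in network _ _ n0 return 'cV[R]_n0 -> 'cV[R]_m with
  | OutputLayer _ A b => fun x => A *m x + b
  | HiddenLayer _ _ A b Psi =>
      fun x => realize rho Psi (map_mx rho (A *m x + b))
  end.

Definition layer_weights (R : realType) (m n : nat)
    (A : 'M[R]_(m, n)) (b : 'cV[R]_m) : seq R :=
  [seq A p.1 p.2 | p : 'I_m * 'I_n] ++ [seq b i ord0 | i : 'I_m].

(* All weights, listed with multiplicity. *)
Fixpoint weights (R : realType) (m n : nat) (Phi : network R m n) : seq R :=
  match Phi with
  | OutputLayer _ A b => layer_weights A b
  | HiddenLayer _ _ A b Psi => layer_weights A b ++ weights Psi
  end.

Definition num_nonzero_weights (R : realType) (m n : nat)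
    (Phi : network R m n) : nat :=
  count (fun w => w != 0) (weights Phi).

Definition is_domain (T : topologicalType) (Omega : set T) : Prop :=
  [/\ open Omega, connected Omega & Omega !=set0].

Definition realization (R : realType) (d : nat) (Omega : set 'cV[R]_d)
    (rho : R -> R) (Phi : network R 1 d) : Omega -> R :=
  fun x => realize rho Phi (val x) ord0 ord0.

Definition NN (R : realType) (d : nat) (Omega : set 'cV[R]_d) (rho : R -> R) :
    set (Omega -> R) :=
  [set realization (Omega := Omega) rho Phi | Phi in [set: network R 1 d]].

(* A normed space of equivalence classes of functions [X -> R]: the element [u]
   of the space is the class [fs_class u]. The axioms force [fs_class 0] to be a
   linear space and every [fs_class u] to be one of its cosets. A space of
   genuine functions is the case in which all the classes are singletons; in
   [L^p] the class of [0] is the set of null functions. *)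
Record funSpace (R : realType) (X : Type) := FunSpace {
  fs_sort :> normedModType R;
  fs_class : fs_sort -> set (X -> R);
  fs_class_nonempty : forall u, fs_class u !=set0;
  fs_class_disjoint : forall u v g, fs_class u g -> fs_class v g -> u = v;
  fs_classD : forall u v g h, fs_class u g -> fs_class v h ->
    fs_class (u + v) (fun x => g x + h x);
  fs_classZ : forall (a : R) u g, fs_class u g ->
    fs_class (a *: u) (fun x => a * g x)
}.

Definition fs_functions (R : realType) (X : Type) (D : funSpace R X) :
    set (X -> R) :=
  [set g | exists v : D, fs_class v g].

(* The inclusion of [C] in [D], up to the usual identification of a function
   with its class: [C] may consist of smaller classes than [D], as in
   continuous functions inside L^2. Such a map is unique, and linear. *)
Definition is_inclusion (R : realType) (X : Type) (C D : funSpace R X)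
    (incl : C -> D) : Prop :=
  injective incl /\ forall f : C, fs_class f `<=` fs_class (incl f).

Definition log2 (R : realType) (x : R) : R := ln x / ln 2.

(* Only the maps with [0 < l] are ever relevant. *)
Definition coding_scheme (R : realType) : Type :=
  forall l : nat, l.-tuple bool -> R.

Definition encodable_networks (R : realType) (B : coding_scheme R)
    (M K d : nat) : set (network R 1 d) :=
  [set Phi | (num_nonzero_weights Phi <= M)%N /\
     forall w, w \in weights Phi -> w != 0 -> range (B K) w].

(* The number of bits is [ceil (C0 * log2 (1 / eps))], which is positive when
   [0 < C0] and [0 < eps < 1]. The element [v] is the one that the realization
   of [Phi] defines in [D]; it is unique by [fs_class_disjoint]. The infimum is
   that of a set of natural numbers, hence a minimum, or [+oo] if it is empty. *)
Definition min_weights_fun (R : realType) (d : nat) (Omega : set 'cV[R]_d)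
    (C D : funSpace R Omega) (incl : C -> D) (B : coding_scheme R)
    (rho : R -> R) (C0 eps : R) (f : C) : \bar R :=
  ereal_inf [set (M%:R : R)%:E | M in [set M : nat | (0 < M)%N /\
    exists2 Phi, encodable_networks B M `|Num.ceil (C0 * log2 (1 / eps))|%N Phi
    & exists2 v : D, fs_class v (realization rho Phi)
      & `|incl f - v| <= eps]].

Definition min_weights (R : realType) (d : nat) (Omega : set 'cV[R]_d)
    (C D : funSpace R Omega) (incl : C -> D) (B : coding_scheme R)
    (rho : R -> R) (C0 eps : R) : \bar R :=
  ereal_sup [set min_weights_fun incl B rho C0 eps f
            | f in [set f : C | `|f| <= 1]].

Definition minimax_code_length (R : realType) (X : Type) (C D : funSpace R X)
    (incl : C -> D) (eps : R) : \bar R :=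
  ereal_inf [set (l%:R : R)%:E | l in [set l : nat | (0 < l)%N /\
    exists (Enc : C -> l.-tuple bool) (Dec : l.-tuple bool -> D),
      (ereal_sup [set (`|Dec (Enc f) - incl f|%R)%:E
                 | f in [set f : C | (`|f| <= 1)%R]] <= eps%:E)%E]].

(* Main.v *)
(* Counting argument. A neuron without nonzero incoming weights computes the
   constant [rho 0], so only the neurons with such a weight, at most [M] in
   number, matter, however wide or deep the network is. Hence the realization
   is computed by a straight-line program with one instruction per nonzero
   weight, each given by a [K]-bit weight, an address of a previously computed
   function (or of a coordinate, [1] or [rho 0]), and one further bit. There are
   at most [2 ^ (M * (b + K + 1))] such programs when [d + 3 + M <= 2 ^ b], which
   bounds the minimax code length by [M * (b + K + 1)]. If
   [M <= eps `^ (- gamma)], then [b] and [K] may be taken of order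
   [log2 (1 / eps)], and the claim follows. *)
Require Import Defs.
From HB Require Import structures.
From mathcomp Require Import all_boot all_order all_algebra.
From mathcomp Require Import all_classical all_reals all_analysis.
From mathcomp Require Import zify ring lra.
Import Order.TTheory GRing.Theory Num.Theory.
Import numFieldNormedType.Exports.
Local Open Scope classical_set_scope.
Local Open Scope ring_scope.

(* A state is a memory of functions and an accumulator. The instruction
   [(a, w, e)] adds [w] times the function at address [a] to the accumulator; the
   flag [e] ends a neuron: [rho] of the accumulator is stored at the end of the
   memory, so that old addresses remain valid. Reading out of range gives [0]. *)
Definition exec_step {R : realType} {X : Type} (rho : R -> R)
    (st : seq (X -> R) * (X -> R)) (c : nat * R * bool) :
    seq (X -> R) * (X -> R) :=
  let acc := st.2 + c.1.2 *: nth 0 st.1 c.1.1 in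
  if c.2 then (rcons st.1 (rho \o acc), 0) else (st.1, acc).

Notation exec rho := (foldl (exec_step rho)).

Definition instr_weight {R : realType} (c : nat * R * bool) : R := c.1.2.

(** * Compiling neurons and layers *)

Definition add_terms {R : realType} {X : Type} (mem : seq (X -> R))
    (ts : seq (R * (X -> R))) : seq (nat * R * bool) :=
  [seq (index t.2 mem, t.1, false) | t <- ts].

Lemma exec_add_terms {R : realType} {X : Type} (rho : R -> R)
    (mem : seq (X -> R)) (ts : seq (R * (X -> R))) (acc : X -> R) :
  (forall t, t \in ts -> t.2 \in mem) ->
  exec rho (mem, acc) (add_terms mem ts) =
    (mem, acc + \sum_(t <- ts) t.1 *: t.2).
Proof.
elim: ts acc => [|t ts IH] acc hts /=; first by rewrite big_nil addr0.
rewrite /exec_step /= nth_index; last by apply: hts; rewrite mem_head.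
by rewrite IH ?big_cons ?addrA// => u hu; apply: hts; rewrite in_cons hu orbT.
Qed.

(** With no terms no instruction is emitted: the output is then the constant [rho 0], already
    stored. Otherwise the last term carries the flag. Thus the program length counts nonzero weights
    only, whatever the width. *)
Lemma exec_neuron {R : realType} {X : Type} (rho : R -> R)
    (mem : seq (X -> R)) (ts : seq (R * (X -> R))) :
  (fun=> rho 0) \in mem -> (forall t, t \in ts -> t.2 \in mem) ->
  exists p mem', [/\ [seq instr_weight c | c <- p] = unzip1 ts,
    exec rho (mem, 0) p = (mem', 0), {subset mem <= mem'} &
    rho \o (\sum_(t <- ts) t.1 *: t.2) \in mem'].
Proof.
move=> h0; case/lastP: ts => [_|ts t hts].
  by exists [::], mem; split=> //; rewrite big_nil.
exists (rcons (add_terms mem ts) (index t.2 mem, t.1, true)).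
exists (rcons mem (rho \o (\sum_(u <- rcons ts t) u.1 *: u.2))); split.
- by rewrite map_rcons /unzip1 map_rcons -map_comp.
- rewrite foldl_rcons exec_add_terms; last first.
    by move=> u hu; apply: hts; rewrite mem_rcons in_cons hu orbT.
  rewrite /exec_step /= nth_index; last first.
    by apply: hts; rewrite mem_rcons mem_head.
  by rewrite -(cats1 ts) big_cat big_seq1 add0r.
- by move=> f hf; rewrite mem_rcons in_cons hf orbT.
- by rewrite mem_rcons mem_head.
Qed.

(** All terms refer to the memory before the layer, which survives each neuron because memory only
    grows. *)
Lemma exec_layer {R : realType} {X : Type} (rho : R -> R)
    (tss : seq (seq (R * (X -> R)))) (mem : seq (X -> R)) :
  (fun=> rho 0) \in mem ->
  (forall ts t, ts \in tss -> t \in ts -> t.2 \in mem) ->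
  exists p mem', [/\ [seq instr_weight c | c <- p] = unzip1 (flatten tss),
    exec rho (mem, 0) p = (mem', 0), {subset mem <= mem'} &
    forall ts, ts \in tss -> rho \o (\sum_(t <- ts) t.1 *: t.2) \in mem'].
Proof.
elim: tss mem => [|ts tss IH] mem h0 htss.
  by exists [::], mem; split=> // ts; rewrite in_nil.
have [|p [mem1 [wp ep sub1 v1]]] := exec_neuron rho mem ts h0.
  by move=> t; apply: htss; rewrite mem_head.
have [||q [mem2 [wq eq sub2 v2]]] := IH mem1; first exact: sub1.
  by move=> us u hus hu; apply/sub1/(htss us) => //; rewrite in_cons hus orbT.
exists (p ++ q), mem2; split.
- by rewrite map_cat wp wq /unzip1 map_cat.
- by rewrite foldl_cat ep.
- by move=> f /sub1 /sub2.
- by move=> us; rewrite in_cons => /orP[/eqP ->|/v2//]; apply: sub2.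
Qed.

(** * From networks to programs *)

Definition neuron_terms {R : realType} {X : Type} {m n : nat}
    (A : 'M[R]_(m, n)) (b : 'cV[R]_m) (h : 'I_n -> X -> R) (i : 'I_m) :
    seq (R * (X -> R)) :=
  [seq t <- (b i ord0, fun=> 1) :: [seq (A i j, h j) | j : 'I_n] | t.1 != 0].

Lemma sum_neuron_terms {R : realType} {X : Type} {m n : nat}
    (A : 'M[R]_(m, n)) (b : 'cV[R]_m) (h : 'I_n -> X -> R) (i : 'I_m) (x : X) :
  (\sum_(t <- neuron_terms A b h i) t.1 *: t.2) x =
    (A *m \col_j h j x + b) i ord0.
Proof.
rewrite fct_sumE big_filter big_mkcond /=.
rewrite (eq_bigr (fun t : R * (X -> R) => t.1 * t.2 x)); last first.
  by move=> t _; case: eqVneq => // ->; rewrite mul0r.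
rewrite big_cons big_image /= mulr1 addrC !mxE; congr (_ + _).
by apply: eq_bigr => j _; rewrite mxE.
Qed.

Lemma neuron_terms_mem {R : realType} {X : Type} {m n : nat}
    (A : 'M[R]_(m, n)) (b : 'cV[R]_m) (h : 'I_n -> X -> R) (i : 'I_m)
    (mem : seq (X -> R)) :
  (fun=> 1) \in mem -> (forall j, h j \in mem) ->
  forall t, t \in neuron_terms A b h i -> t.2 \in mem.
Proof.
move=> h1 hh t; rewrite mem_filter in_cons => /andP[_ /orP[/eqP ->//|]].
by case/mapP => j _ ->; apply: hh.
Qed.

(** Only a permutation: the terms put each bias next to its row, while [layer_weights] lists all
    biases last. *)
Lemma perm_layer_weights {R : realType} {X : Type} {m n : nat}
    (A : 'M[R]_(m, n)) (b : 'cV[R]_m) (h : 'I_n -> X -> R) :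
  perm_eq (unzip1 (flatten [seq neuron_terms A b h i | i : 'I_m]))
          [seq w <- layer_weights A b | w != 0].
Proof.
apply/permP => a.
rewrite count_filter /unzip1 count_map count_flatten sumnE !big_map.
rewrite /layer_weights count_cat !count_map.
under eq_bigr => i _.
  rewrite /neuron_terms count_filter /= count_map.
  over.
rewrite big_split /= addnC -!sum1_count.
congr (_ + _)%N; last first.
  by rewrite [RHS]big_mkcond; apply: eq_bigr => i _ /=; case: ifP.
rewrite [RHS]big_mkcond /=.
rewrite -(pair_bigA _ (fun i j =>
  if predI a (fun w => w != 0) (A i j) then 1%N else 0%N)) /=.
by apply: eq_bigr => i _; rewrite -sum1_count big_mkcond big_enum.
Qed.

(** General [h] and [mem] let the induction feed the stored outputs of one layer to the rest of the
    network. The output layer sets no flag, so its value stays in the accumulator, without [rho]. *)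
Lemma exec_network {R : realType} {X : Type} (rho : R -> R) {n : nat}
    (Phi : network R 1 n) (h : 'I_n -> X -> R) (mem : seq (X -> R)) :
  (fun=> rho 0) \in mem -> (fun=> 1) \in mem -> (forall j, h j \in mem) ->
  exists2 p, perm_eq [seq instr_weight c | c <- p]
                     [seq w <- weights Phi | w != 0] &
    (exec rho (mem, 0) p).2 =
      fun x => realize rho Phi (\col_j h j x) ord0 ord0.
Proof.
elim: Phi h mem => [{}n A b|{}n k A b Psi IH] h mem h0 h1 hh.
  exists (add_terms mem (neuron_terms A b h ord0)).
    have := perm_layer_weights A b h.
    rewrite /image_mem enum_ordSl (size0nil (size_enum_ord 0)) /= cats0.
    by rewrite -map_comp.
  rewrite exec_add_terms; last exact: neuron_terms_mem.
  by apply/funext => x; rewrite /= add0r sum_neuron_terms.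
have [|p [mem' [wp ep sub hp]]] :=
  exec_layer rho [seq neuron_terms A b h i | i : 'I_k.+1] mem h0.
  by move=> ts t /mapP[i _ ->]; apply: neuron_terms_mem.
have [|||q wq eq] :=
    IH (fun i => rho \o (\sum_(t <- neuron_terms A b h i) t.1 *: t.2)) mem'.
- exact: sub.
- exact: sub.
- by move=> j; apply: hp; apply/mapP; exists j; rewrite ?mem_enum.
exists (p ++ q).
  by rewrite map_cat /= filter_cat perm_cat// wp perm_layer_weights.
rewrite foldl_cat ep eq.
apply/funext => x /=; congr (realize _ _ _ _ _).
by apply/colP => i; rewrite [LHS]mxE [RHS]mxE /= sum_neuron_terms.
Qed.

(** * Programs as finite codes *)

(** An instruction stores at most one function, so the memory size stays at most [N] and all
    addresses from [N] on read [0]. Clamping bounds the addresses without tracking them during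
    compilation. *)
Lemma exec_clamp {R : realType} {X : Type} (rho : R -> R) (N : nat)
    (p : seq (nat * R * bool)) (mem : seq (X -> R)) (acc : X -> R) :
  (size mem + size p <= N)%N ->
  exec rho (mem, acc) [seq (minn c.1.1 N, c.1.2, c.2) | c <- p] =
  exec rho (mem, acc) p.
Proof.
elim: p mem acc => // c p IH mem acc hN /=.
have -> : exec_step rho (mem, acc) (minn c.1.1 N, c.1.2, c.2) =
          exec_step rho (mem, acc) c.
  rewrite /exec_step /=.
  suff -> : nth 0 mem (minn c.1.1 N) = nth 0 mem c.1.1 by [].
  case: (leqP c.1.1 N) => // hc; rewrite !nth_default //.
    by apply: leq_trans (ltnW hc); apply: leq_trans hN; apply: leq_addr.
  by apply: leq_trans hN; apply: leq_addr.
rewrite /exec_step; case: ifP => _; rewrite IH //=.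
  by rewrite size_rcons addSnnS.
by apply: leq_trans hN; rewrite leq_add2l.
Qed.

Lemma exec_pad {R : realType} {X : Type} (rho : R -> R) (k N : nat) (w : R)
    (mem : seq (X -> R)) (acc : X -> R) :
  (size mem <= N)%N -> exec rho (mem, acc) (nseq k (N, w, false)) = (mem, acc).
Proof.
move=> hN; elim: k => //= k IH.
by rewrite /exec_step /= nth_default// scaler0 addr0.
Qed.

Definition program_code (K b M : nat) : finType :=
  M.-tuple ('I_(2 ^ b) * K.-tuple bool * bool)%type.

Lemma card_program_code (K b M : nat) :
  #|program_code K b M| = (2 ^ (M * (b + K + 1)))%N.
Proof.
rewrite card_tuple !card_prod card_ord card_tuple card_bool.
by rewrite -expnD -expnSr -expnM mulnC addn1.
Qed.

Definition initial_mem {R : realType} {d : nat} (rho : R -> R)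
    (Omega : set 'cV[R]_d) : seq (Omega -> R) :=
  [:: (fun=> rho 0), (fun=> 1) &
      [seq (fun x : Omega => val x j ord0) | j : 'I_d]].

(** [rho] and [B] are known to the decoder, so they cost no bits. *)
Definition run_code {R : realType} {d : nat} {Omega : set 'cV[R]_d}
    (rho : R -> R) (B : coding_scheme R) (K b M : nat)
    (q : program_code K b M) : Omega -> R :=
  (exec rho (initial_mem rho Omega, 0)
     [seq (nat_of_ord c.1.1, B K c.1.2, c.2) | c <- q]).2.

Lemma run_code_surj {R : realType} {d : nat} {Omega : set 'cV[R]_d}
    (rho : R -> R) (B : coding_scheme R) (K b M : nat) (Phi : network R 1 d) :
  (d + 3 + M <= 2 ^ b)%N -> encodable_networks B M K Phi ->
  exists q : program_code K b M,
    run_code rho B K b M q = realization (Omega := Omega) rho Phi.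
Proof.
move=> hb [hM hB].
pose mem := initial_mem rho Omega.
have smem : size mem = d.+2 by rewrite /= size_map size_enum_ord.
have [|||p wp ep] :=
  exec_network rho Phi (fun j (x : Omega) => val x j ord0) mem.
- by rewrite mem_head.
- by rewrite !in_cons eqxx orbT.
- move=> j; rewrite !in_cons (map_f (fun j (x : Omega) => val x j ord0)) ?orbT//.
  by rewrite mem_enum.
(* The memory never exceeds [N], so address [N] always reads [0]: it serves
   both for clamping addresses and for padding instructions. *)
pose N := (d.+2 + M)%N.
(* The [3] in [hb] accounts for [rho 0], [1] and the spare address [N]. *)
have hN : (N < 2 ^ b)%N by apply: leq_trans hb; rewrite /N; lia.
have sp : (size p <= M)%N.
  by rewrite -(size_map instr_weight) (perm_size wp) size_filter.
have code_w c : c \in p -> exists t : K.-tuple bool, B K t = c.1.2.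
  move=> /(map_f instr_weight); rewrite (perm_mem wp) mem_filter.
  by move=> /andP[w0 /hB /(_ w0)] [t _ ht]; exists t.
pose t0 : K.-tuple bool := [tuple of nseq K false].
have [q0 hq0] : exists q0 : seq ('I_(2 ^ b) * K.-tuple bool * bool)%type,
    [seq (nat_of_ord c.1.1, B K c.1.2, c.2) | c <- q0] =
    [seq (minn c.1.1 N, c.1.2, c.2) | c <- p].
  elim: p code_w {wp ep sp} => [|c p IH] hp; first by exists [::].
  have [|q0 hq0] := IH.
    by move=> e he; apply: hp; rewrite in_cons he orbT.
  have [|t ht] := hp c; first by rewrite mem_head.
  have hc : (minn c.1.1 N < 2 ^ b)%N by rewrite gtn_min hN orbT.
  by exists ((Ordinal hc, t, c.2) :: q0); rewrite /= hq0 ht.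
(* Padding goes in front, where the memory is still the initial one, of size [d.+2 <= N]. *)
pose s := nseq (M - size p) (Ordinal hN, t0, false) ++ q0.
have ss : size s == M.
  have : size q0 = size p.
    by rewrite -(size_map (fun c => (minn c.1.1 N, c.1.2, c.2))) -hq0 size_map.
  by rewrite size_cat size_nseq => ->; rewrite subnK.
exists (Tuple ss).
rewrite /run_code /= map_cat map_nseq /= foldl_cat exec_pad; last first.
  by rewrite -/mem smem leq_addr.
rewrite -/mem hq0 exec_clamp; last by rewrite smem leq_add2l.
rewrite ep; apply/funext => x; rewrite /realization; congr (realize _ _ _ _ _).
by apply/colP => j; rewrite mxE.
Qed.

(** * Code length and logarithmic estimates *)

Lemma minimax_code_length_le {R : realType} {X : Type} (C D : funSpace R X)
    (incl : C -> D) (eps : R) (l : nat) (P : finType) (dec : P -> D) :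
  (0 < l)%N -> (#|P| <= 2 ^ l)%N ->
  (forall f : C, `|f| <= 1 -> exists q, `|incl f - dec q| <= eps) ->
  (minimax_code_length incl eps <= (l%:R : R)%:E)%E.
Proof.
move=> l0 hP hdec; apply: ereal_inf_lbound; exists l => //; split=> //.
have hl : (#|P| <= #|{: l.-tuple bool}|)%N by rewrite card_tuple card_bool.
pose code (q : P) : l.-tuple bool := enum_val (widen_ord hl (enum_rank q)).
have code_inj : injective code.
  by move=> q r /enum_val_inj /(congr1 val) /= /val_inj /enum_rank_inj.
have [q0 _] : exists q, `|incl 0 - dec q| <= eps by apply: hdec; rewrite normr0.
have /boolp.choice[enc henc] : forall f : C,
    exists q, `|f| <= 1 -> `|incl f - dec q| <= eps.
  move=> f.
  have [/hdec[q hq]|hf] := pselect (`|f| <= 1); first by exists q.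
  by exists q0.
exists (code \o enc).
exists (fun t => if [pick q | code q == t] is Some q then dec q else 0).
apply: ge_ereal_sup => _ [f /= hf <-]; rewrite lee_fin.
case: pickP => [q /eqP /code_inj ->|/(_ (enc f))]; last by rewrite eqxx.
by rewrite distrC henc.
Qed.

Lemma powR_le_pow2 {R : realType} (eps gamma : R) (k : nat) :
  0 < eps -> gamma * log2 (1 / eps) <= k%:R -> eps `^ (- gamma) <= 2 ^+ k.
Proof.
move=> e0 hk.
have ln20 : 0 < ln 2 :> R by rewrite ln_gt0// ltr1n.
rewrite -powR_mulrn// /powR !gt_eqF// ler_expR.
have -> : - gamma * ln eps = gamma * log2 (1 / eps) * ln 2.
  by rewrite /log2 div1r lnV ?posrE// mulrA mulfVK ?gt_eqF// mulrN mulNr.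
by rewrite ler_pM2r.
Qed.

Lemma log2_inv_gt1 {R : realType} (eps : R) :
  0 < eps -> eps < 1 / 2 -> 1 < log2 (1 / eps).
Proof.
move=> e0 e1; have ln20 : 0 < ln 2 :> R by rewrite ln_gt0// ltr1n.
rewrite /log2 !div1r in e1 *.
rewrite ltr_pdivlMr// mul1r ltr_ln ?posrE ?invr_gt0//.
by rewrite -[ltLHS]invrK ltf_pV2 ?posrE ?invr_gt0.
Qed.

Lemma natr_absz_ceil_le {R : realType} (x : R) :
  0 <= x -> x <= `|Num.ceil x|%N%:R <= x + 1.
Proof.
move=> x0; have c0 : 0 <= Num.ceil x by rewrite -(ceil0 R); apply: le_ceil.
have -> : `|Num.ceil x|%N%:R = (Num.ceil x)%:~R :> R.
  by rewrite -[in RHS](gez0_abs c0).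
by rewrite ceil_ge/= -lerBlDr -(intrB _ _ 1) ltW// ceilB1_lt.
Qed.

(** * Counting and choice of constants *)

Theorem theorem3p5 (R : realType) (d : nat) (hd : (0 < d)%N)
    (Omega : set 'cV[R]_d) (hOmega : is_domain Omega)
    (C D : funSpace R Omega) (incl : C -> D) (hincl : is_inclusion incl)
    (gamma C1 : R) (hgamma : 0 < gamma) (hC1 : 0 < C1)
    (hL : forall eps : R, 0 < eps ->
      ((C1 * eps `^ (- gamma))%:E <= minimax_code_length incl eps)%E)
    (C0 : R) (hC0 : 0 < C0) :
  exists2 Cst : R, 0 < Cst &
    forall rho : R -> R, NN rho `<=` fs_functions D ->
    forall (B : coding_scheme R) (eps : R), 0 < eps -> eps < 1 / 2 ->
      ((Cst * eps `^ (- gamma) / log2 (1 / eps))%:E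
        <= min_weights incl B rho C0 eps)%E.
Proof.
(* Chosen so that [b + K + 1 <= x * S] once [x > 1]; [7] is the [4] in [b], one for each of two
   ceilings, and the final [1]. *)
pose S : R := C0 + gamma + d%:R + 7.
have S0 : 0 < S by rewrite /S; have := ler0n R d; lra.
have den0 : 0 < C1 + S by lra.
(* Being below [1], it gives [M <= E]; being below [C1 / S], it makes the final inequality
   strict. *)
exists (C1 / (C1 + S)); first by rewrite divr_gt0.
move=> rho _ B eps e0 e2; rewrite leNgt; apply/negP => hlt.
set x := log2 (1 / eps) in hlt.
set E := eps `^ (- gamma) in hlt.
have x1 : 1 < x := log2_inv_gt1 eps e0 e2.
have x0 : 0 < x := lt_trans ltr01 x1.
have E0 : 0 < E by rewrite powR_gt0.
set T := C1 / (C1 + S) * E / x in hlt.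
have T0 : 0 <= T by rewrite /T ltW// divr_gt0// mulr_gt0// divr_gt0.
pose M := Num.truncn T.
have MT : M%:R <= T by rewrite truncn_le.
set K := `|Num.ceil (C0 * x)|%N.
have approx (f : C) : `|f| <= 1 -> exists Phi, [/\ (0 < M)%N,
    encodable_networks B M K Phi &
    exists2 v : D, fs_class v (realization rho Phi) & `|incl f - v| <= eps].
  move=> hf; have : (min_weights_fun incl B rho C0 eps f < T%:E)%E.
    by apply: le_lt_trans hlt; apply: ereal_sup_ubound; exists f.
  case/ereal_inf_lt => _ [m [m0 [Phi [hm hB] hv]] <-]; rewrite lte_fin => mT.
  have mM : (m <= M)%N by rewrite /M truncn_ge_nat// ltW.
  exists Phi; split=> //; first exact: leq_trans mM.
  by split=> //; apply: leq_trans mM.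
(* Approximating [0] already takes a positive count [m <= M]. *)
have M0 : (0 < M)%N by have [|? []] := approx 0; rewrite ?normr0.
pose K' := `|Num.ceil (gamma * x)|%N.
have /andP[_ hK] : C0 * x <= K%:R <= C0 * x + 1.
  by apply: natr_absz_ceil_le; rewrite mulr_ge0//; lra.
have /andP[hK'l hK'] : gamma * x <= K'%:R <= gamma * x + 1.
  by apply: natr_absz_ceil_le; rewrite mulr_ge0//; lra.
have TE : T * x * (C1 + S) = C1 * E.
  by rewrite /T; field; rewrite !gt_eqF.
have ME : M%:R <= E.
  apply: le_trans MT _; rewrite -(ler_pM2r den0).
  apply: (@le_trans _ _ (C1 * E)).
    by rewrite -TE ler_pM2r// ler_peMr// ltW.
  by rewrite mulrC ler_pM2l// lerDl ltW.
(* [K'] bits cover [M], and [d + 4] bits the factor in [d + 3 + M <= (d + 4) * 2 ^ K']. *)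
pose b := (d + 4 + K')%N.
have hb : (d + 3 + M <= 2 ^ b)%N.
  have M2 : (M <= 2 ^ K')%N.
    rewrite -(ler_nat R) natrX; apply: le_trans ME _.
    exact: powR_le_pow2.
  have d2 : (d + 4 <= 2 ^ (d + 4))%N by apply/ltnW/ltn_expl.
  rewrite /b expnD; apply: (leq_trans _ (leq_mul d2 (leqnn _))).
  by rewrite [(d + 4)%N]addnS mulSn [leqRHS]addnC leq_add// leq_pmulr// expn_gt0.
pose l := (M * (b + K + 1))%N.
have hlen : (minimax_code_length incl eps <= (l%:R : R)%:E)%E.
  (* Codes whose function lies in no class of [D] decode to [0]. *)
  pose dec (q : program_code K b M) : D :=
    xget 0 [set v | fs_class v (run_code (Omega := Omega) rho B K b M q)].
  apply: (minimax_code_length_le C D incl eps l _ dec).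
  - by rewrite /l muln_gt0 M0 addn1.
  - by rewrite card_program_code.
  move=> f /approx[Phi [_ hPhi [v hv hfv]]].
  have [q hq] := @run_code_surj _ _ Omega rho B K b M Phi hb hPhi.
  exists q; suff -> : dec q = v by [].
  rewrite /dec hq; case: xgetP => [w -> hw|/(_ v) []//].
  exact: fs_class_disjoint hw hv.
have := le_trans (hL eps e0) hlen; rewrite lee_fin -/E => hle.
have lS : l%:R <= T * (x * S).
  rewrite /l natrM ler_pM// /b !natrD /S.
  have : (d%:R + 7) * 1 <= (d%:R + 7) * x by rewrite ler_wpM2l ?addr_ge0// ltW.
  lra.
(* The contradiction is [C1 * E <= l <= T * x * S < T * x * (C1 + S) = C1 * E]. *)
have T1 : 0 < T by apply: lt_le_trans MT; rewrite ltr0n.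
have : 0 < T * x * C1 by rewrite mulr_gt0// mulr_gt0.
lra.
Qed.
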